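(* Let $p\geqslant1$ and let $f_1,\ldots,f_p:\mathbb{R}^D\to\mathbb{R}^D$ be linear maps. Assume that there exist two subspaces $V,W\subset\mathbb{R}^D$ satisfying $V\oplus W=\mathbb{R}^D$ and, for all $i\in\{1,\ldots,p\}$, (i) $(f_i-\mathrm{Id})(V)\subset W$, (ii) $f_i(W)\subset W$ and the linear map $f_{i,W}:W\to W$ induced by $f_i$ is a contraction. Then $\big(H^n(K_0)\big)_n$ converges for all $K_0\in\mathcal{K}$ to the set $$L=\mathrm{cl}\Big(\bigcup_{v_0\in p_{V,W}(K_0)}v_0+\widetilde{L}(v_0)\Big),$$ where $p_{V,W}$ is the projection onto $V$ along $W$ and, for $v_0\in V$, $\widetilde{L}(v_0)$ is the attractor of the iterated function system $\{\widetilde f_1,\ldots,\widetilde f_p\}$, with $\widetilde f_i:W\to W$ defined by $\widetilde f_i(w)=f_{i,W}(w)+(f_i-\mathrm{Id})(v_0)$. In particular, $p_{V,W}(L)=p_{V,W}(K_0)$.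
   Context: $D\geqslant1$; $\mathbb{R}^D$ carries the Euclidean norm $\|\cdot\|$; a map is a contraction if its Lipschitz constant (for a linear map, its operator norm induced by $\|\cdot\|$) is $<1$. $\mathcal{K}$ is the set of non-empty compact subsets of $\mathbb{R}^D$, with the Hausdorff metric; convergence of sets is with respect to this metric. $\mathrm{cl}$ denotes closure. $H(K)=\bigcup_{i=1}^pf_i(K)$ is the Hutchinson operator. The attractor of a system of contractions $\{g_1,\ldots,g_p\}$ of $W$ is the unique non-empty compact set $A\subset W$ with $A=\bigcup_{i=1}^pg_i(A)$. *)

(* Defs.v *)
From HB Require Import structures.
From mathcomp Require Import all_boot all_order all_algebra.
From mathcomp Require Import all_classical all_reals all_analysis.
Import Order.TTheory GRing.Theory Num.Theory.
Import numFieldNormedType.Exports.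

Set Implicit Arguments.
Unset Strict Implicit.
Unset Printing Implicit Defensive.

Local Open Scope classical_set_scope.
Local Open Scope ring_scope.

(* R^D is 'rV[R]_D.  The library's norm on matrices is the sup norm, so every
   metric notion below goes through the Euclidean norm enorm; compact, closure
   and continuity only depend on the topology, which is the same for both. *)
Definition enorm (R : realType) (D : nat) (x : 'rV[R]_D) : R :=
  Num.sqrt (\sum_(j < D) x 0 j ^+ 2).

Definition edist (R : realType) (D : nat) (x : 'rV[R]_D) (A : set 'rV[R]_D) : R :=
  inf [set enorm (x - a) | a in A].

(* Real-valued sup and inf: meaningful for non-empty bounded sets only. *)
Definition hausdorff_dist (R : realType) (D : nat) (A B : set 'rV[R]_D) : R :=
  Num.max (sup [set edist a B | a in A]) (sup [set edist b A | b in B]).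

Definition nonempty_compact (R : realType) (D : nat) (A : set 'rV[R]_D) : Prop :=
  A !=set0 /\ compact A.

(* Convergence in the metric space of non-empty compact sets: the terms and the
   limit are required to be points of that space. *)
Definition hausdorff_cvg (R : realType) (D : nat)
    (K : nat -> set 'rV[R]_D) (L : set 'rV[R]_D) : Prop :=
  [/\ forall n, nonempty_compact (K n), nonempty_compact L
    & (fun n => hausdorff_dist (K n) L) @ \oo --> (0 : R)].

Definition hutchinson (T : Type) (p : nat) (g : 'I_p -> T -> T) (K : set T) : set T :=
  \bigcup_(i in [set: 'I_p]) (g i @` K).

(* A map W -> W is represented by a map of the ambient space that sends W to W,
   of which only the values on W matter. *)

(* For a linear g with g(W) included in W, this is the operator norm of the
   restriction of g to W. *)
Definition lipschitz_const (R : realType) (D : nat) (W : {vspace 'rV[R]_D})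
    (g : 'rV[R]_D -> 'rV[R]_D) : \bar R :=
  ereal_inf [set k%:E | k in [set k : R | 0 <= k /\
    forall x y, x \in W -> y \in W -> enorm (g x - g y) <= k * enorm (x - y)]].

Definition contraction_of (R : realType) (D : nat) (W : {vspace 'rV[R]_D})
    (g : 'rV[R]_D -> 'rV[R]_D) : Prop :=
  (forall w, w \in W -> g w \in W) /\ (lipschitz_const W g < 1)%E.

Definition self_similar (R : realType) (D p : nat) (W : {vspace 'rV[R]_D})
    (g : 'I_p -> 'rV[R]_D -> 'rV[R]_D) (A : set 'rV[R]_D) : Prop :=
  [/\ nonempty_compact A, forall a, A a -> a \in W & A = hutchinson g A].

(* The set A with self_similar W g A; it exists and is unique when every g i is
   a contraction of W, and set0 is only the default outside that case. *)
Definition attractor (R : realType) (D p : nat) (W : {vspace 'rV[R]_D})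
    (g : 'I_p -> 'rV[R]_D -> 'rV[R]_D) : set 'rV[R]_D :=
  xget set0 [set A | self_similar W g A].

Definition ftilde (R : realType) (D p : nat) (f : 'I_p -> 'End('rV[R]_D))
    (v0 : 'rV[R]_D) (i : 'I_p) (w : 'rV[R]_D) : 'rV[R]_D :=
  f i w + (f i - \1%VF) v0.

Definition limit_set (R : realType) (D p : nat) (V W : {vspace 'rV[R]_D})
    (f : 'I_p -> 'End('rV[R]_D)) (K0 : set 'rV[R]_D) : set 'rV[R]_D :=
  closure (\bigcup_(v0 in daddv_pi V W @` K0)
    [set v0 + w | w in attractor W (ftilde f v0)]).

(* Main.v *)
Require Import Defs.
From mathcomp Require Import all_boot all_order all_algebra.
From mathcomp Require Import all_classical all_reals all_analysis.
From mathcomp Require Import ring.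

(** Write pi for the projection onto V along W.  For v in V and w in W,
    f_i (v + w) = v + ftilde_v,i (w): every f_i preserves each coset v + W and
    acts on it as the affine contraction ftilde_v,i.  Two points of the same
    coset are therefore brought closer by a factor k < 1 common to all the
    f_i, whatever the coset.

    Let U be the union of the sets v + L(v), for v in pi(K0) and L(v) the
    attractor of the system (ftilde_v,i)_i.  Self-similarity of the L(v) says
    exactly that H(U) = U ([hutchinson_fibered_attractor]).  Every point of K0
    has a point of U in its own coset, and conversely, at distance at most
    some M, because K0 and U are bounded ([fibered_attractor_near]).  The
    Hutchinson operator multiplies such a bound by k ([hutchinson_near]), so
    H^n(K0) and U = H^n(U) are within M k^n of each other, and H^n(K0)
    converges to the closure of U.  Since pi(U) = pi(K0) is compact and pi is
    continuous, taking the closure does not change the projection.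

    The same bound, applied to two self-similar sets, gives uniqueness of the
    attractor ([self_similar_unique]).  Its existence comes from monotonicity,
    in the manner of Knaster and Tarski: if F is the Hutchinson operator of
    contractions of W, the union of all subsets S of an invariant ball of W
    with S included in F(S) is a fixed point of F, and it is compact
    ([affine_attractor_exists]).  For the ftilde_v,i the radius of that ball is
    controlled by the displacements (f_i - Id)(v), hence is uniform for v in
    pi(K0), and this makes U bounded. *)

Import Order.TTheory GRing.Theory Num.Theory.
Import numFieldNormedType.Exports.

Set Implicit Arguments.
Unset Strict Implicit.
Unset Printing Implicit Defensive.

Local Open Scope classical_set_scope.
Local Open Scope ring_scope.

(** * The Euclidean norm and the topology of row vectors *)

(** The sum of the squares (b x_j - c y_j)^2, where b = |y|^2 and c = <x, y>,
    is b (|x|^2 b - c^2). *)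
Lemma CauchySchwarz_sum (R : realType) (D : nat) (x y : 'I_D -> R) :
  (\sum_j x j * y j) ^+ 2 <= (\sum_j x j ^+ 2) * (\sum_j y j ^+ 2).
Proof.
set c := \sum_j _ * _; set a := \sum_j x j ^+ 2; set b := \sum_j y j ^+ 2.
have b0 : 0 <= b by apply: sumr_ge0 => j _; exact: sqr_ge0.
have [bE|bn0] := eqVneq b 0.
  have y0 j : y j = 0.
    apply/eqP; rewrite -sqrf_eq0; apply/eqP.
    apply: (@psumr_eq0P _ _ xpredT (fun j => y j ^+ 2)) => // i _.
    exact: sqr_ge0.
  by rewrite /c big1 ?expr0n ?bE ?mulr0 // => j _; rewrite y0 mulr0.
have : 0 <= \sum_j (b * x j - c * y j) ^+ 2.
  by apply: sumr_ge0 => j _; exact: sqr_ge0.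
have -> : \sum_j (b * x j - c * y j) ^+ 2 = b * (a * b - c ^+ 2).
  have -> : \sum_j (b * x j - c * y j) ^+ 2 =
      \sum_j (b ^+ 2 * x j ^+ 2 - 2 * b * c * (x j * y j) + c ^+ 2 * y j ^+ 2).
    by apply: eq_bigr => j _; ring.
  rewrite big_split /= sumrB -!mulr_sumr -/a -/b -/c; ring.
by rewrite pmulr_rge0 ?lt_neqAle ?b0 ?andbT 1?eq_sym // subr_ge0.
Qed.

Section EuclideanNorm.
Variables (R : realType) (D : nat).
Implicit Types (x y : 'rV[R]_D) (A B K U : set 'rV[R]_D).

Lemma enorm_ge0 x : 0 <= enorm x.
Proof. exact: sqrtr_ge0. Qed.

Lemma enorm0 : enorm (0 : 'rV[R]_D) = 0.
Proof. by rewrite /enorm big1 ?sqrtr0 // => j _; rewrite mxE expr0n. Qed.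

Lemma enormN x : enorm (- x) = enorm x.
Proof. by congr Num.sqrt; apply: eq_bigr => j _; rewrite mxE sqrrN. Qed.

Lemma enormD x y : enorm (x + y) <= enorm x + enorm y.
Proof.
have s0 z : 0 <= \sum_(j < D) (z : 'rV[R]_D) 0 j ^+ 2.
  by apply: sumr_ge0 => j _; exact: sqr_ge0.
rewrite -(@ler_pXn2r _ 2) ?nnegrE ?addr_ge0 ?enorm_ge0 //.
rewrite sqrrD !sqr_sqrtr // -sqrtrM //.
have -> : \sum_(j < D) (x + y) 0 j ^+ 2 =
   \sum_(j < D) x 0 j ^+ 2 + (\sum_(j < D) x 0 j * y 0 j) *+ 2
   + \sum_(j < D) y 0 j ^+ 2.
  rewrite -sumrMnl -!big_split /=; apply: eq_bigr => j _.
  by rewrite mxE sqrrD.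
rewrite lerD2r lerD2l lerMn2r /=; apply: le_trans (ler_norm _) _.
by rewrite -sqrtr_sqr; apply: ler_wsqrtr; exact: CauchySchwarz_sum.
Qed.

Lemma enorm_sub x y : enorm (x - y) <= enorm x + enorm y.
Proof. by rewrite -(enormN y); exact: enormD. Qed.

(** Transfers Euclidean bounds to the topology, which is that of the sup norm;
    the other direction goes through the continuity of [enorm]. *)
Lemma mx_norm_le_enorm x : `|x| <= enorm x.
Proof.
rewrite [`|x|]mx_normrE; apply: bigmax_le => [|[i j] _ /=].
  exact: enorm_ge0.
rewrite (ord1 i) -sqrtr_sqr; apply: ler_wsqrtr.
rewrite (bigD1 j) //= lerDl; apply: sumr_ge0 => l _; exact: sqr_ge0.
Qed.

Lemma continuous_sum (T : topologicalType) (V : normedModType R) (I : Type)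
    (s : seq I) (F : I -> T -> V) :
  (forall i, continuous (F i)) -> continuous (fun t => \sum_(i <- s) F i t).
Proof.
move=> cF; elim: s => [|i s IHs] t.
  by under eq_fun do rewrite big_nil; exact: cvg_cst.
by under eq_fun do rewrite big_cons; apply: continuousD; [exact: cF|exact: IHs].
Qed.

Lemma enorm_continuous : continuous (@enorm R D).
Proof.
move=> x; apply: (@continuous_comp _ _ _
  (fun y : 'rV[R]_D => \sum_(j < D) y 0 j ^+ 2) Num.sqrt);
  last exact: sqrt_continuous.
apply: continuous_sum => j y.
pose coord (z : 'rV[R]_D) := z 0 j.
by apply: (@continuousM _ _ coord coord);
  exact: coord_continuous.
Qed.

(** In coordinates, h x is a finite sum of terms x_j h(e_j). *)
Lemma linfun_continuous (h : 'End('rV[R]_D)) : continuous h.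
Proof.
have -> : h = (fun x : 'rV[R]_D => \sum_(j < D) x 0 j *: h (delta_mx 0 j))
    :> (_ -> _).
  apply/funext => x; rewrite {1}[x]row_sum_delta linear_sum.
  by apply: eq_bigr => j _; rewrite linearZ.
apply: continuous_sum => j x.
by apply: continuousZr_tmp; exact: coord_continuous.
Qed.

(** W is the zero set of the continuous map Id - projv W. *)
Lemma closed_vspace (W : {vspace 'rV[R]_D}) : closed [set w | w \in W].
Proof.
have -> : [set w | w \in W] = (\1%VF - projv W)%VF @^-1` [set 0].
  apply/seteqP; split=> w /=.
    by move=> wW; rewrite add_lfunE opp_lfunE id_lfunE projv_id // subrr.
  rewrite add_lfunE opp_lfunE id_lfunE => /eqP; rewrite subr_eq0 => /eqP ->.
  exact: memv_proj.
have /continuous_closedP := @linfun_continuous (\1%VF - projv W)%VF.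
by apply; apply: compact_closed; [exact: norm_hausdorff|exact: compact_set1].
Qed.

Lemma closed_enorm_ball (r : R) : closed [set x : 'rV[R]_D | enorm x <= r].
Proof.
have /continuous_closedP := enorm_continuous.
by move=> /(_ [set t | t <= r]); apply; exact: closed_le.
Qed.

Lemma compact_of_enorm A (r : R) :
  closed A -> (forall a, A a -> enorm a <= r) -> compact A.
Proof.
move=> cA Ar; apply: bounded_closed_compact => //.
exists r; split; first exact: num_real.
move=> M rM x Ax; apply: (le_trans (mx_norm_le_enorm x)).
exact: le_trans (Ar x Ax) (ltW rM).
Qed.

Lemma compact_enorm_bound A : compact A ->
  exists2 M, 0 <= M & forall a, A a -> enorm a <= M.
Proof.
move=> cA; have [A0|A0] := pselect (A !=set0); last first.
  by exists 0 => // a Aa; case: A0; exists a.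
have cE : {within A, continuous (@enorm R D)}.
  by apply: continuous_subspaceT; exact: enorm_continuous.
have [c _ cmax] := compact_EVT_max A0 cA cE.
by exists (enorm c); [exact: enorm_ge0|move=> a Aa; apply: cmax; rewrite inE].
Qed.

Lemma closure_enorm A x (e : R) :
  closure A x -> 0 < e -> exists2 a, A a & enorm (x - a) < e.
Proof.
move=> clA e0.
have /clA [a [Aa xa]] : nbhs x [set y | enorm (x - y) < e].
  have ct : {for x, continuous (fun y : 'rV[R]_D => enorm (x - y))}.
    apply: (@continuous_comp _ _ _ (fun y : 'rV[R]_D => x - y) (@enorm R D));
      last exact: enorm_continuous.
    by apply: continuousB => //; exact: cst_continuous.
  apply: (ct [set t | t < e]); rewrite subrr enorm0.
  exact: (@lt_nbhsl R 0 e).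
by exists a.
Qed.

Lemma enorm_closure A x :
  (forall e : R, 0 < e -> exists2 a, A a & enorm (x - a) < e) -> closure A x.
Proof.
move=> Ax B /nbhs_normP[e /= e0 xeB]; have [a Aa xa] := Ax e e0.
exists a; split=> //; apply: xeB => /=.
exact: le_lt_trans (mx_norm_le_enorm _) xa.
Qed.

Lemma edist_ge0 x A : 0 <= Defs.edist x A.
Proof.
have [A0|A0] := pselect ([set enorm (x - a) | a in A] !=set0).
  by apply: lb_le_inf => // _ [a _ <-]; exact: enorm_ge0.
by rewrite /Defs.edist; move/set0P/negP/negPn/eqP : A0 => ->; rewrite inf0.
Qed.

Lemma edist_le x A a : A a -> Defs.edist x A <= enorm (x - a).
Proof.
move=> Aa; apply: ge_inf; last by exists a.
by exists 0 => _ [b _ <-]; exact: enorm_ge0.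
Qed.

Lemma hausdorff_dist_le A B (e : R) : A !=set0 -> B !=set0 ->
  (forall a, A a -> Defs.edist a B <= e) ->
  (forall b, B b -> Defs.edist b A <= e) ->
  0 <= hausdorff_dist A B <= e.
Proof.
move=> [a0 Aa0] [b0 Bb0] AB BA; apply/andP; split.
  rewrite le_max; apply/orP; left; apply: le_trans (edist_ge0 a0 B) _.
  by apply: ub_le_sup; [exists e => _ [a Aa <-]; exact: AB|exists a0].
by rewrite ge_max; apply/andP; split; apply: ge_sup;
  [exists (Defs.edist a0 B), a0|move=> _ [a Aa <-]; exact: AB|
   exists (Defs.edist b0 A), b0|move=> _ [b Bb <-]; exact: BA].
Qed.

End EuclideanNorm.

(** * Hutchinson operators that contract the cosets of a subspace *)

Section Hutchinson.
Variables (R : realType) (D p : nat).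
Implicit Types (g : 'I_p -> 'rV[R]_D -> 'rV[R]_D) (A B K U : set 'rV[R]_D).
Implicit Types (W : {vspace 'rV[R]_D}).

Lemma hutchinson_mono (T : Type) (h : 'I_p -> T -> T) (A B : set T) :
  A `<=` B -> hutchinson h A `<=` hutchinson h B.
Proof. by move=> AB x [i _ [a /AB Ba <-]]; exists i => //; exists a. Qed.

Lemma hutchinson_nonempty_compact g K : (0 < p)%N ->
  (forall i, continuous (g i)) -> nonempty_compact K ->
  nonempty_compact (hutchinson g K).
Proof.
move=> p0 cg [[x Kx] cK]; split.
  by exists (g (Ordinal p0) x), (Ordinal p0) => //; exists x.
have -> : hutchinson g K = \big[setU/set0]_(i <- enum 'I_p) (g i @` K).
  rewrite -bigcup_seq; apply: eq_bigcupl.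
  by split=> i //= _; rewrite mem_enum.
apply: bigsetU_compact => i _; apply: continuous_compact => //.
by apply: continuous_subspaceT; exact: cg.
Qed.

Lemma hutchinson_iter_nonempty_compact g K n : (0 < p)%N ->
  (forall i, continuous (g i)) -> nonempty_compact K ->
  nonempty_compact (iter n (hutchinson g) K).
Proof.
by move=> p0 cg cK; elim: n => //= n; exact: hutchinson_nonempty_compact.
Qed.

(** On W, this is the usual contraction property for a map that sends W to W.
    Comparing points of an arbitrary common coset makes the notion apply both
    to the f_i on the whole space and to the ftilde_v,i. *)
Definition coset_contraction W (k : R) (h : 'rV[R]_D -> 'rV[R]_D) : Prop :=
  forall x y, x - y \in W ->
    h x - h y \in W /\ enorm (h x - h y) <= k * enorm (x - y).

(** One half of a Hausdorff-distance bound, where moreover the nearby point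
    must lie in the same coset of W: without that, the bound would not shrink
    under a [coset_contraction]. *)
Definition coset_near W (e : R) A B : Prop :=
  forall a, A a -> exists2 b, B b & a - b \in W /\ enorm (a - b) <= e.

Lemma hutchinson_near W (k : R) g (e : R) A B : 0 <= k ->
  (forall i, coset_contraction W k (g i)) -> coset_near W e A B ->
  coset_near W (k * e) (hutchinson g A) (hutchinson g B).
Proof.
move=> k0 gk AB _ [i _ [a Aa <-]]; have [b Bb [abW abe]] := AB a Aa.
have [gW ge] := gk i a b abW.
exists (g i b); first by exists i => //; exists b.
by split=> //; apply: le_trans ge _; rewrite ler_wpM2l.
Qed.

Lemma iter_hutchinson_near W (k : R) g (e : R) A B n : 0 <= k ->
  (forall i, coset_contraction W k (g i)) -> coset_near W e A B ->
  coset_near W (e * k ^+ n) (iter n (hutchinson g) A) (iter n (hutchinson g) B).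
Proof.
move=> k0 gk AB; elim: n => [|n IHn]; first by rewrite expr0 mulr1.
by rewrite exprS mulrCA; exact: hutchinson_near.
Qed.

Lemma iter_hutchinson_fixed (T : Type) (h : 'I_p -> T -> T) (A : set T) n :
  hutchinson h A = A -> iter n (hutchinson h) A = A.
Proof. by move=> hA; elim: n => //= n ->. Qed.

(** Both sets are bounded, hence at finite mutual distance; they are their own
    images under the n-th iterate, so that distance is at most a constant times
    k^n for every n, and B is closed. *)
Lemma self_similar_sub W (k : R) g A B : 0 <= k < 1 ->
  (forall i, coset_contraction W k (g i)) ->
  self_similar W g A -> self_similar W g B -> A `<=` B.
Proof.
move=> /andP[k0 k1] gk [[_ cA] AW AE] [[[b0 Bb0] cB] BW BE] a Aa.
have clB : closed B by apply: compact_closed => //; exact: norm_hausdorff.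
have [MA _ AM] := compact_enorm_bound cA.
have [MB _ BM] := compact_enorm_bound cB.
have AB : coset_near W (MA + MB) A B.
  move=> x Ax; exists b0 => //; split.
    by apply: rpredB; [exact: AW|exact: BW].
  apply: le_trans (enorm_sub _ _) _.
  by apply: lerD; [exact: AM|exact: BM].
rewrite ((closure_id B).1 clB); apply: enorm_closure => e e0.
have /cvgrPdist_lt/(_ e e0)[n _ /(_ n (leqnn n))] :
    geometric (MA + MB) k @ \oo --> 0.
  by apply: cvg_geometric; rewrite ger0_norm.
rewrite /= sub0r normrN => /ltr_normlW nE.
have := @iter_hutchinson_near W k g _ A B n k0 gk AB.
rewrite (iter_hutchinson_fixed n (esym AE)).
rewrite (iter_hutchinson_fixed n (esym BE)) => /(_ a Aa)[b Bb [_ abe]].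
by exists b => //; exact: le_lt_trans abe nE.
Qed.

Lemma self_similar_unique W (k : R) g A B : 0 <= k < 1 ->
  (forall i, coset_contraction W k (g i)) ->
  self_similar W g A -> self_similar W g B -> A = B.
Proof.
by move=> k01 gk sA sB; apply/seteqP; split; exact: (self_similar_sub k01 gk).
Qed.

(** Id - h is injective on W, since a fixed vector w satisfies |w| <= k |w|; by
    counting dimensions it maps W onto W. *)
Lemma affine_fixed_point W (k : R) (h : 'End('rV[R]_D)) b : k < 1 ->
  (h @: W <= W)%VS -> (forall w, w \in W -> enorm (h w) <= k * enorm w) ->
  b \in W -> exists2 w, w \in W & h w + b = w.
Proof.
move=> k1 hW hk bW; pose u := (\1 - h)%VF.
have uE w : u w = w - h w by rewrite add_lfunE opp_lfunE id_lfunE.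
have ker0 : (W :&: lker u = 0)%VS.
  apply/eqP; rewrite -subv0; apply/subvP => w.
  rewrite memv_cap memv_ker uE subr_eq0 => /andP[wW /eqP wE].
  have := hk w wW; rewrite -wE => wk; rewrite memv0 -normr_le0.
  apply: le_trans (mx_norm_le_enorm w) _.
  have k1' : 0 < 1 - k by rewrite subr_gt0.
  by rewrite -(pmulr_rle0 _ k1') mulrBl mul1r subr_le0.
have uW : (u @: W = W)%VS.
  apply/eqP; rewrite eqEdim (limg_dim_eq ker0) leqnn andbT.
  apply/subvP => _ /memv_imgP[w wW ->]; rewrite uE rpredB //.
  by apply: (subvP hW); exact: memv_img.
move: bW; rewrite -{1}uW => /memv_imgP[w wW bE].
by exists w => //; rewrite bE uE addrC subrK.
Qed.

(** The bound on the b_i is what makes the ball of radius r in W invariant.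
    Let F be the Hutchinson operator; the union A of all S in this ball with S
    included in F(S) satisfies A = F(A) by monotonicity of F.  Its closure has
    the same two properties, because the image of a compact set is closed;
    hence A is closed.  It is not empty as it contains the fixed point of one
    of the maps. *)
Lemma affine_attractor_exists W (k r : R) (f : 'I_p -> 'End('rV[R]_D))
    (b : 'I_p -> 'rV[R]_D) : (0 < p)%N -> 0 <= k < 1 ->
  (forall i, (f i @: W <= W)%VS) ->
  (forall i w, w \in W -> enorm (f i w) <= k * enorm w) ->
  (forall i, b i \in W) -> (forall i, enorm (b i) <= (1 - k) * r) ->
  exists2 A, self_similar W (fun i w => f i w + b i) A &
    forall a, A a -> enorm a <= r.
Proof.
move=> p0 /andP[k0 k1] fW fk bW br; set g := fun i w => _.
pose ball := [set w | w \in W] `&` [set w | enorm w <= r].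
have cball : closed ball.
  by apply: closedI; [exact: closed_vspace|exact: closed_enorm_ball].
have gball : hutchinson g ball `<=` ball.
  move=> _ [i _ [w [/= wW wr] <-]]; split => /=.
    by rewrite rpredD // (subvP (fW i)) // memv_img.
  apply: le_trans (enormD _ _) _.
  have -> : r = k * r + (1 - k) * r by ring.
  rewrite lerD // (le_trans (fk i w wW)) // ler_wpM2l //.
have cg i : continuous (g i).
  move=> x; apply: (@continuousD _ _ _ (f i) (cst (b i)) x).
    exact: linfun_continuous.
  exact: cst_continuous.
pose A := [set x | exists S, [/\ S `<=` ball, S `<=` hutchinson g S & S x]].
have Aball : A `<=` ball by move=> x [S [Sb _ /Sb]].
have Amax S : S `<=` ball -> S `<=` hutchinson g S -> S `<=` A.
  by move=> Sb Sg x Sx; exists S.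
have AgA : A `<=` hutchinson g A.
  move=> x [S [Sb Sg Sx]]; apply: hutchinson_mono (Sg _ Sx); exact: Amax.
have gAA : hutchinson g A `<=` A.
  apply: Amax; last exact: hutchinson_mono.
  by move=> x gx; apply: gball; exact: hutchinson_mono gx.
have A0 : A !=set0.
  pose i := Ordinal p0.
  have [w wW wE] := affine_fixed_point k1 (fW i) (fk i) (bW i).
  exists w, [set w]; split=> // [_ ->|_ ->]; last by exists i => //; exists w.
  split=> //=; have k1' : 0 < 1 - k by rewrite subr_gt0.
  rewrite -(ler_pM2l k1'); apply: le_trans (br i).
  rewrite mulrBl mul1r lerBlDl -{1}wE; apply: le_trans (enormD _ _) _.
  by rewrite lerD2r fk.
have clAball : closure A `<=` ball.
  by rewrite {1}(closure_id ball).1 //; exact: closureS.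
have clA0 : nonempty_compact (closure A).
  split; first by case: A0 => x Ax; exists x; exact: subset_closure.
  apply: (@compact_of_enorm _ _ _ r); first exact: closed_closure.
  by move=> a /clAball[].
have clAA : closure A `<=` A.
  apply: Amax => //.
  have gcl : closed (hutchinson g (closure A)).
    apply: compact_closed; first exact: norm_hausdorff.
    by have [] := hutchinson_nonempty_compact p0 cg clA0.
  rewrite [X in _ `<=` X](closure_id _).1 //; apply: closureS.
  by apply: subset_trans AgA _; apply: hutchinson_mono; exact: subset_closure.
have AE : A = closure A by apply/seteqP; split=> //; exact: subset_closure.
exists A; last by move=> a /Aball[].
split; [by rewrite AE|by move=> a /Aball[]|].
by apply/seteqP; split.
Qed.

End Hutchinson.

(** * From the contraction hypothesis to a uniform ratio *)

Section UniformContraction.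
Variables (R : realType) (D : nat).
Implicit Types (W : {vspace 'rV[R]_D}).

Lemma contraction_of_linear W (h : 'End('rV[R]_D)) : contraction_of W h ->
  exists k : R, 0 <= k < 1 /\ forall w, w \in W -> enorm (h w) <= k * enorm w.
Proof.
move=> [_ /ereal_inf_lt[_ [k [k0 hk] <-]]]; rewrite lte_fin => k1.
exists k; split; first by rewrite k0.
by move=> w wW; have := hk w 0 wW (mem0v W); rewrite linear0 !subr0.
Qed.

Lemma contraction_of_linear_uniform p W (f : 'I_p -> 'End('rV[R]_D)) :
  (forall i, contraction_of W (f i)) ->
  exists k : R, 0 <= k < 1 /\
    forall i w, w \in W -> enorm (f i w) <= k * enorm w.
Proof.
move=> fc; have [k kP] := choice (fun i => contraction_of_linear (fc i)).
exists (\big[Num.max/0]_i k i); split.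
  apply/andP; split; first exact: bigmax_ge_id.
  by apply: bigmax_lt => // i _; have [/andP[]] := kP i.
move=> i w wW; have [_ /(_ w wW) ki] := kP i; apply: le_trans ki _.
by rewrite ler_wpM2r ?enorm_ge0 //; exact: le_bigmax.
Qed.

Lemma coset_contraction_affine W (k : R) (h : 'End('rV[R]_D)) b :
  (h @: W <= W)%VS -> (forall w, w \in W -> enorm (h w) <= k * enorm w) ->
  coset_contraction W k (fun w => h w + b).
Proof.
move=> hW hk x y xyW; rewrite opprD addrACA subrr addr0 -linearB.
by split; [apply: (subvP hW); exact: memv_img|exact: hk].
Qed.

Lemma contraction_of_coset W (k : R) (h : 'rV[R]_D -> 'rV[R]_D) : 0 <= k < 1 ->
  (forall w, w \in W -> h w \in W) -> coset_contraction W k h ->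
  contraction_of W h.
Proof.
move=> /andP[k0 k1] hW hk; split=> //.
apply: (@le_lt_trans _ _ k%:E); last by rewrite lte_fin.
apply: ereal_inf_lbound; exists k => //; split=> // x y xW yW.
by have [] := hk x y (rpredB xW yW).
Qed.

End UniformContraction.

(** * The projection along a complement *)

Section Complement.
Variables (K : fieldType) (vT : vectType K) (V W : {vspace vT}).
Hypotheses (hVW0 : (V :&: W)%VS = 0%VS) (hVW : (V + W)%VS = fullv).

Lemma sub_daddv_pi x : x - daddv_pi V W x \in W.
Proof.
have xE : daddv_pi V W x + daddv_pi W V x = x.
  by apply: daddv_pi_add; rewrite // hVW memvf.
by rewrite -{1}xE addrC addKr memv_pi.
Qed.

Lemma daddv_pi_add_compl v w : v \in V -> w \in W -> daddv_pi V W (v + w) = v.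
Proof.
move=> vV wW; apply/eqP; rewrite -subr_eq0 -memv0 -hVW0 memv_cap.
rewrite rpredB ?memv_pi //=.
have := rpredB wW (sub_daddv_pi (v + w)).
by rewrite opprB opprD addrCA [w + _]addrCA subrr addr0.
Qed.

End Complement.

(** * The attractors of the cosets and the limit set *)

Section LimitSet.
Variables (R : realType) (D p : nat) (f : 'I_p -> 'End('rV[R]_D)).
Variables (V W : {vspace 'rV[R]_D}).
Hypotheses (p0 : (0 < p)%N).
Hypotheses (hVW0 : (V :&: W)%VS = 0%VS) (hVW : (V + W)%VS = fullv).
Hypothesis hV : forall i, ((f i - \1%VF) @: V <= W)%VS.
Hypothesis hW : forall i, (f i @: W <= W)%VS.
Variable k : R.
Hypothesis k01 : 0 <= k < 1.
Hypothesis fk : forall i w, w \in W -> enorm (f i w) <= k * enorm w.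

Let bW v0 i : v0 \in V -> (f i - \1%VF)%VF v0 \in W.
Proof. by move=> v0V; apply: (subvP (hV i)); exact: memv_img. Qed.

Lemma ftilde_coset_contraction v0 i : coset_contraction W k (ftilde f v0 i).
Proof. by apply: coset_contraction_affine; [exact: hW|exact: fk]. Qed.

Lemma ftilde_contraction v0 i : v0 \in V -> contraction_of W (ftilde f v0 i).
Proof.
move=> v0V; apply: contraction_of_coset k01 _ (ftilde_coset_contraction v0 i).
by move=> w wW; rewrite rpredD ?bW //; apply: (subvP (hW i)); exact: memv_img.
Qed.

(** The attractor constructed by [affine_attractor_exists] lies in the ball of
    radius r, so by uniqueness the chosen one does. *)
Lemma ftilde_attractor_bound v0 r : v0 \in V ->
  (forall i, enorm ((f i - \1%VF)%VF v0) <= (1 - k) * r) ->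
  self_similar W (ftilde f v0) (attractor W (ftilde f v0)) /\
  forall a, attractor W (ftilde f v0) a -> enorm a <= r.
Proof.
move=> v0V br.
have [A sA Ar] := affine_attractor_exists p0 k01 hW fk (fun i => bW i v0V) br.
have sL : self_similar W (ftilde f v0) (attractor W (ftilde f v0)).
  apply: (@xgetPex _ set0 [set B | self_similar W (ftilde f v0) B]).
  by exists A.
split=> // a.
rewrite (self_similar_unique k01 (ftilde_coset_contraction v0) sL sA).
exact: Ar.
Qed.

(** Makes the radius in [ftilde_attractor_bound] uniform over a compact set of
    base points. *)
Lemma ftilde_displacement_bound (C : set 'rV[R]_D) : compact C ->
  exists r, forall v0 i, C v0 -> enorm ((f i - \1%VF)%VF v0) <= (1 - k) * r.
Proof.
move=> cC; have k1 : 0 < 1 - k by rewrite subr_gt0; case/andP: k01.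
have H i : exists M, forall v0, C v0 -> enorm ((f i - \1%VF)%VF v0) <= M.
  have cfC : compact ((f i - \1%VF)%VF @` C).
    apply: continuous_compact => //; apply: continuous_subspaceT.
    exact: linfun_continuous.
  have [M _ CM] := compact_enorm_bound cfC.
  by exists M => v0 Cv0; apply: CM; exists v0.
have [M MP] := choice H.
exists ((1 - k)^-1 * \big[Num.max/0]_i M i) => v0 i Cv0.
rewrite mulrA mulfV ?gt_eqF // mul1r; apply: le_trans (MP i v0 Cv0) _.
exact: le_bigmax.
Qed.

Lemma ftilde_attractor v0 : v0 \in V ->
  self_similar W (ftilde f v0) (attractor W (ftilde f v0)).
Proof.
move=> v0V; have [r rP] := ftilde_displacement_bound (@compact_set1 _ v0).
by have [] := ftilde_attractor_bound v0V (fun i => rP v0 i erefl).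
Qed.

(** The limit set before taking its closure. *)
Definition fibered_attractor (K0 : set 'rV[R]_D) : set 'rV[R]_D :=
  \bigcup_(v0 in daddv_pi V W @` K0)
    [set v0 + w | w in attractor W (ftilde f v0)].

(** Because f_i (v + w) = v + ftilde_v,i (w), the operator H acts on the part of
    the set in the coset v + W as the Hutchinson operator of the ftilde_v,i,
    which fixes the attractor. *)
Lemma hutchinson_fibered_attractor K0 :
  hutchinson f (fibered_attractor K0) = fibered_attractor K0.
Proof.
have fE i v w : f i (v + w) = v + ftilde f v i w.
  rewrite /ftilde add_lfunE opp_lfunE id_lfunE linearD.
  by rewrite [RHS]addrCA [v + (_ - _)]addrCA subrr addr0 addrC.
have LE v0 : (daddv_pi V W @` K0) v0 ->
    attractor W (ftilde f v0) =
      hutchinson (ftilde f v0) (attractor W (ftilde f v0)).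
  by move=> [x _ <-]; have [] := ftilde_attractor (memv_pi V W x).
apply/seteqP; split=> [_ [i _ [_ [v v0K [w Lw <-]] <-]]|_ [v v0K [w Lw <-]]].
  exists v => //; exists (ftilde f v i w); last by rewrite fE.
  by rewrite LE //; exists i => //; exists w.
move: Lw; rewrite LE // => -[i _ [w' Lw' <-]].
by exists i => //; exists (v + w'); [exists v => //; exists w'|exact: fE].
Qed.

(** A point x of K0 and any point pi(x) + w of the set over pi(x) are in the
    same coset, and both are bounded; each side has such partners because the
    attractors are not empty and the base points come from K0. *)
Lemma fibered_attractor_near K0 : nonempty_compact K0 ->
  exists2 M, (forall u, fibered_attractor K0 u -> enorm u <= M) &
    coset_near W M K0 (fibered_attractor K0) /\
    coset_near W M (fibered_attractor K0) K0.
Proof.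
move=> [_ cK0].
have cpK : compact (daddv_pi V W @` K0).
  apply: continuous_compact => //; apply: continuous_subspaceT.
  exact: linfun_continuous.
have [r rP] := ftilde_displacement_bound cpK.
have [M M0 KM] := compact_enorm_bound cK0.
have [N N0 pKN] := compact_enorm_bound cpK.
have Lr v0 : (daddv_pi V W @` K0) v0 ->
    self_similar W (ftilde f v0) (attractor W (ftilde f v0)) /\
    forall a, attractor W (ftilde f v0) a -> enorm a <= r.
  move=> pv0; apply: ftilde_attractor_bound => [|i]; last exact: rP.
  by case: pv0 => x _ <-; exact: memv_pi.
have UN u : fibered_attractor K0 u -> enorm u <= N + r.
  move=> [v pv [w Lw <-]]; apply: le_trans (enormD _ _) _.
  by rewrite lerD ?pKN //; have [_] := Lr v pv; exact.
have near x w : K0 x -> attractor W (ftilde f (daddv_pi V W x)) w ->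
    x - (daddv_pi V W x + w) \in W /\
    enorm (x - (daddv_pi V W x + w)) <= M + (N + r).
  move=> Kx Lw; have px : (daddv_pi V W @` K0) (daddv_pi V W x) by exists x.
  split.
    have [[_ LW _] _] := Lr _ px.
    by rewrite opprD addrA rpredB ?sub_daddv_pi // LW.
  apply: le_trans (enorm_sub _ _) _; rewrite lerD ?KM //; apply: UN.
  by exists (daddv_pi V W x) => //; exists w.
exists (M + (N + r)); first by move=> u /UN uN; rewrite (le_trans uN) // lerDr.
split=> [x Kx|_ [_ [x Kx <-] [w Lw <-]]].
  have px : (daddv_pi V W @` K0) (daddv_pi V W x) by exists x.
  have [[[[w Lw] _] _ _] _] := Lr _ px.
  exists (daddv_pi V W x + w); last exact: near.
  by exists (daddv_pi V W x) => //; exists w.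
exists x => //; have [xW xM] := near x w Kx Lw.
by rewrite -opprB rpredN enormN.
Qed.

Lemma limit_set_nonempty_compact K0 : nonempty_compact K0 ->
  nonempty_compact (limit_set V W f K0).
Proof.
move=> ncK0; have [M UM [KU _]] := fibered_attractor_near ncK0.
split.
  have [[x Kx] _] := ncK0; have [u Uu _] := KU x Kx.
  by exists u; exact: subset_closure.
apply: (@compact_of_enorm _ _ _ M); first exact: closed_closure.
have cb := @closed_enorm_ball R D M.
move=> a La; suff : [set x : 'rV[R]_D | enorm x <= M] a by [].
by rewrite ((closure_id _).1 cb); exact: closureS La.
Qed.

Lemma coset_contraction_f i : coset_contraction W k (f i).
Proof.
have := coset_contraction_affine 0 (hW i) (@fk i).
by congr coset_contraction; apply/funext => w; rewrite addr0.
Qed.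

(** The [coset_near] relations of [fibered_attractor_near] are pushed through n
    iterations; the invariant set stays put, and passing to its closure costs
    an arbitrarily small e. *)
Lemma hausdorff_cvg_limit_set K0 : nonempty_compact K0 ->
  hausdorff_cvg (fun n => iter n (hutchinson f) K0) (limit_set V W f K0).
Proof.
move=> ncK0; have [k0 k1] := andP k01.
have ncn n : nonempty_compact (iter n (hutchinson f) K0).
  by apply: hutchinson_iter_nonempty_compact => // i; exact: linfun_continuous.
have ncL := limit_set_nonempty_compact ncK0.
split=> //; have [M _ [KU UK]] := fibered_attractor_near ncK0.
have UE n := @iter_hutchinson_fixed _ _ _ _ n (hutchinson_fibered_attractor K0).
apply: (@squeeze_cvgr _ _ _ _ (cst 0) (geometric M k)).
- apply: nearW => n /=.
  have := @iter_hutchinson_near _ _ _ W k _ _ _ _ n k0 coset_contraction_f KU.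
  have := @iter_hutchinson_near _ _ _ W k _ _ _ _ n k0 coset_contraction_f UK.
  rewrite UE => UKn KUn.
  apply: hausdorff_dist_le; [exact: (ncn n).1|exact: ncL.1| |].
    move=> a /KUn[b Ub [_ abe]]; apply: le_trans abe; apply: edist_le.
    exact: subset_closure.
  move=> a La; apply/ler_addgt0Pr => e e0.
  have [u Uu au] := closure_enorm La e0; have [b Kb [_ ub]] := UKn u Uu.
  apply: le_trans (edist_le _ Kb) _.
  have -> : a - b = (u - b) + (a - u) by rewrite [RHS]addrC subrKA.
  by apply: le_trans (enormD _ _) _; rewrite lerD // ltW.
- exact: cvg_cst.
- by apply: cvg_geometric; rewrite ger0_norm.
Qed.

(** The preimage under pi of the compact set pi(K0) is closed and contains the
    union of the v + L(v), hence its closure. *)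
Lemma daddv_pi_limit_set K0 : nonempty_compact K0 ->
  daddv_pi V W @` limit_set V W f K0 = daddv_pi V W @` K0.
Proof.
move=> ncK0; have [_ cK0] := ncK0.
have piU u : fibered_attractor K0 u -> (daddv_pi V W @` K0) (daddv_pi V W u).
  move=> [_ [x Kx <-] [w Lw <-]]; exists x => //.
  have [_ LW _] := ftilde_attractor (memv_pi V W x).
  by rewrite daddv_pi_add_compl ?memv_pi // LW.
have cpi : continuous (daddv_pi V W) by exact: linfun_continuous.
have clpK : closed (daddv_pi V W @` K0).
  apply: compact_closed; first exact: norm_hausdorff.
  by apply: continuous_compact => //; exact: continuous_subspaceT.
apply/seteqP; split=> [_ [a La <-]|_ [x Kx <-]].
  have clpre := (continuous_closedP _).1 cpi _ clpK.
  suff : (daddv_pi V W @^-1` (daddv_pi V W @` K0)) a by [].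
  by rewrite ((closure_id _).1 clpre); exact: closureS La.
have [w Lw] : attractor W (ftilde f (daddv_pi V W x)) !=set0.
  by have [[]] := ftilde_attractor (memv_pi V W x).
have [_ LW _] := ftilde_attractor (memv_pi V W x).
exists (daddv_pi V W x + w); last by rewrite daddv_pi_add_compl ?memv_pi // LW.
apply: subset_closure; exists (daddv_pi V W x); first by exists x.
by exists w.
Qed.

End LimitSet.

Theorem theorem3p7 (R : realType) (D p : nat) (hD : (1 <= D)%N) (hp : (1 <= p)%N)
    (f : 'I_p -> 'End('rV[R]_D)) (V W : {vspace 'rV[R]_D})
    (hVW0 : (V :&: W)%VS = 0%VS) (hVW : (V + W)%VS = fullv)
    (hV : forall i, ((f i - \1%VF) @: V <= W)%VS)
    (hW : forall i, (f i @: W <= W)%VS)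
    (hc : forall i, contraction_of W (f i)) :
  (forall v0, v0 \in V ->
     (forall i, contraction_of W (ftilde f v0 i)) /\
     unique (self_similar W (ftilde f v0)) (attractor W (ftilde f v0))) /\
  (forall K0 : set 'rV[R]_D, nonempty_compact K0 ->
     hausdorff_cvg (fun n => iter n (hutchinson f) K0) (limit_set V W f K0) /\
     daddv_pi V W @` limit_set V W f K0 = daddv_pi V W @` K0).
Proof.
have [k [k01 fk]] := contraction_of_linear_uniform hc.
split=> [v0 v0V|K0 ncK0]; split.
- by move=> i; exact: (ftilde_contraction hV hW k01 fk).
- have sL := ftilde_attractor hp hV hW k01 fk v0V.
  split=> // A sA.
  exact: (self_similar_unique k01 (ftilde_coset_contraction hW fk v0) sL sA).
- exact: (hausdorff_cvg_limit_set hp hVW0 hVW hV hW k01 fk).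
- exact: (daddv_pi_limit_set hp hVW0 hVW hV hW k01 fk).
Qed.
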